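(* Let $n\ge 1$ and let $\mathbb{F}_q$ be a finite field. The discrete series character $\delta=\delta(n,\mathbb{F}_q)$ has value $$\delta(g)=(-1)^{r(g)}\cdot (q-1)\cdot (q^2-1)\cdots (q^{n-1-r(g)}-1)$$ at $g\in U(n,\mathbb{F}_q)$, where $r(g)$ is the rank of $g-I$.
   Context: $U(n,\mathbb{F}_q)$ is the group of upper triangular unipotent $n\times n$ matrices over $\mathbb{F}_q$, $\mathfrak{u}(n,\mathbb{F}_q)$ is the algebra of upper triangular nilpotent (strictly upper triangular) matrices, with basis the matrix units $e_{ij}$ ($1\le i<j\le n$), and $\mathfrak{u}^*(n,\mathbb{F}_q)$ is its $\mathbb{F}_q$-linear dual. For $\lambda\in\mathfrak{u}^*(n,\mathbb{F}_q)$, $\mathrm{supp}(\lambda)$ is the set of positions $(i,j)$ with $\lambda(e_{ij})\ne 0$. Let $\Delta(n,\mathbb{F}_q)$ be the set of $\lambda\in\mathfrak{u}^*(n,\mathbb{F}_q)$ such that $\mathrm{supp}(\lambda)$ contains at least one position in each of the first $n-1$ rows. It is closed under the left action $(g*\lambda)(X)=\lambda(Xg)$ of $U(n,\mathbb{F}_q)$. Fix a non-trivial homomorphism $\theta$ from the additive group of $\mathbb{F}_q$ to $\mathbb{C}^\times$. Let $\mathbb{C}[U(n,\mathbb{F}_q)]$ be the space of complex-valued functions on $U(n,\mathbb{F}_q)$, carrying the regular representation $(g*v)(g')=v(g'g)$, and put $v(\lambda)(g)=\theta[\lambda(g-I)]$. The span of $\{v(\lambda):\lambda\in\Delta(n,\mathbb{F}_q)\}$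 is a submodule $D(n,\mathbb{F}_q)$ of the regular representation, and the discrete series character $\delta(n,\mathbb{F}_q)$ of $U(n,\mathbb{F}_q)$ is by definition its character. An empty product is $1$. *)

(* Defs.v *)
From HB Require Import structures.
From mathcomp Require Import all_boot all_order all_fingroup all_algebra.
From mathcomp Require Import all_field all_character.

Set Implicit Arguments.
Unset Strict Implicit.
Unset Printing Implicit Defensive.

Import GRing.Theory.

Local Open Scope ring_scope.

Lemma ord_gt_eqF n (i j : 'I_n) : (i < j)%N -> (j == i) = false.
Proof. by move=> lt_ij; rewrite -val_eqE /= gtn_eqF. Qed.

Lemma span_ind (K : fieldType) (vT : vectType K) (X : seq vT) (P : vT -> Prop) :
    P 0 -> (forall a u v, P u -> P v -> P (a *: u + v)) ->
    (forall v, v \in X -> P v) -> forall v, v \in <<X>>%VS -> P v.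
Proof.
move=> P0 PD PX v /(coord_span (X := in_tuple X)) ->.
apply: (big_ind P) => [//|u w Pu Pw|i _].
  by rewrite -[u]scale1r; apply: PD.
rewrite -[_ *: _]addr0; apply: PD => //; apply/PX/mem_nth/ltn_ord.
Qed.

Section UnipotentGroup.
Variables (n : nat) (F : finFieldType).

Definition is_unitri (M : 'M[F]_n) : bool :=
  [forall i : 'I_n, forall j : 'I_n, (j <= i)%N ==> (M i j == (i == j)%:R)].

Lemma is_unitriP (M : 'M[F]_n) :
  reflect (forall i j : 'I_n, (j <= i)%N -> M i j = (i == j)%:R) (is_unitri M).
Proof.
apply: (iffP forallP) => [h i j le_ji|h i].
  by apply/eqP; move/forallP: (h i) => /(_ j)/implyP; apply.
by apply/forallP => j; apply/implyP => /h ->.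
Qed.

Record unitri : predArgType :=
  Unitri { unitri_mx :> 'M[F]_n; _ : is_unitri unitri_mx }.

HB.instance Definition _ := [isSub for unitri_mx].
HB.instance Definition _ := [Finite of unitri by <:].

Lemma unitri1_subproof : is_unitri 1%:M.
Proof. by apply/is_unitriP => i j _; rewrite mxE. Qed.
Definition unitri1 := Unitri unitri1_subproof.

Lemma unitriM_subproof (g h : unitri) : is_unitri (val g *m val h).
Proof.
have /is_unitriP gP := valP g; have /is_unitriP hP := valP h.
apply/is_unitriP => i j le_ji; rewrite mxE (bigD1 i) //= gP // eqxx mul1r hP //.
rewrite big1 ?addr0 // => k ne_ki.
have [le_ki|lt_ik] := leqP k i; first by rewrite gP // eq_sym (negPf ne_ki) mul0r.
have lt_jk := leq_ltn_trans le_ji lt_ik.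
by rewrite hP 1?ltnW // (ord_gt_eqF lt_jk) mulr0.
Qed.
Definition unitri_mul g h := Unitri (unitriM_subproof g h).

Lemma unitri_unitmx (g : unitri) : val g \in unitmx.
Proof.
have /is_unitriP gP := valP g.
rewrite unitmxE -det_tr det_trig ?big1 ?unitr1 // => [i _|].
  by rewrite mxE gP ?eqxx.
by apply/is_trig_mxP => i j lt_ij; rewrite mxE gP 1?ltnW // (ord_gt_eqF lt_ij).
Qed.

Lemma unitriV_subproof (g : unitri) : is_unitri (invmx (val g)).
Proof.
have inj_g : injective (unitri_mul^~ g).
  move=> h1 h2 /(congr1 val) /= e; apply/val_inj/(can_inj (mulmxK (unitri_unitmx g))).
  exact: e.
have /(congr1 val) /= e := f_invF inj_g unitri1.
by rewrite -[invmx _]mul1mx -e mulmxK ?unitri_unitmx //; apply: valP.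
Qed.
Definition unitri_inv g := Unitri (unitriV_subproof g).

Lemma unitri_mulA : associative unitri_mul.
Proof. by move=> g h k; apply/val_inj/mulmxA. Qed.
Lemma unitri_mul1 : left_id unitri1 unitri_mul.
Proof. by move=> g; apply/val_inj/mul1mx. Qed.
Lemma unitri_mulV : left_inverse unitri1 unitri_inv unitri_mul.
Proof. by move=> g; apply/val_inj/mulVmx/unitri_unitmx. Qed.

HB.instance Definition _ := Finite_isGroup.Build unitri
  unitri_mulA unitri_mul1 unitri_mulV.

Lemma unitri_mxM (g h : unitri) : unitri_mx (g * h)%g = unitri_mx g *m unitri_mx h.
Proof. by []. Qed.
Lemma unitri_mx1 : unitri_mx (1%g : unitri) = 1%:M.
Proof. by []. Qed.
Lemma unitriE (g : unitri) (i j : 'I_n) :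
  (j <= i)%N -> unitri_mx g i j = (i == j)%:R.
Proof. by move: i j; apply/is_unitriP/(valP g). Qed.

End UnipotentGroup.

Section NilpotentAlgebra.
Variables (n : nat) (F : finFieldType).

Definition nilalg : {vspace 'M[F]_n} :=
  <<[seq delta_mx ij.1 ij.2 | ij in [pred ij : 'I_n * 'I_n | (ij.1 < ij.2)%N]]>>%VS.

Lemma nilalgP (X : 'M[F]_n) :
  reflect (forall i j : 'I_n, (j <= i)%N -> X i j = 0) (X \in nilalg).
Proof.
apply: (iffP idP) => [|X0].
  move=> Xn; apply: (span_ind (P := fun X : 'M_n => forall i j : 'I_n,
    (j <= i)%N -> X i j = 0)) Xn => [i j _|a Y Z Y0 Z0 i j le_ji|Y].
  - by rewrite mxE.
  - by rewrite !mxE Y0 // Z0 // mulr0 addr0.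
  case/imageP=> -[a b] /= lt_ab -> i j le_ji; rewrite mxE.
  case: eqP => [ea|//]; case: eqP => [eb|//].
  by move: le_ji; rewrite ea eb leqNgt [(_ < _)%N]lt_ab.
rewrite (matrix_sum_delta X); apply: memv_suml => i _; apply: memv_suml => j _.
have [/X0 ->|lt_ij] := leqP j i; first by rewrite scale0r mem0v.
by apply/memvZ/memv_span/imageP; exists (i, j).
Qed.

(* finvect_type only adds the canonical finType structure. *)
Definition nildual : predArgType := finvect_type 'Hom(subvs_of nilalg, F^o).

(* vsproj nilalg X is X itself, as an element of the subspace, if X \in nilalg;
   below, this is only used at such X. *)
Definition nileval (l : nildual) (X : 'M[F]_n) : F :=
  (l : 'Hom(subvs_of nilalg, F^o)) (vsproj nilalg X).

Definition nilsupp (l : nildual) : {set 'I_n * 'I_n} :=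
  [set ij : 'I_n * 'I_n | (ij.1 < ij.2)%N && (nileval l (delta_mx ij.1 ij.2) != 0)].

Definition discrete_functionals : {set nildual} :=
  [set l | [forall i : 'I_n,
    (i.+1 < n)%N ==> [exists j : 'I_n, (i, j) \in nilsupp l]]].

End NilpotentAlgebra.

(* Homomorphisms from the additive group of F to the multiplicative group of
   C. *)
Record addchar (F : finFieldType) (C : fieldType) := AddChar {
  addchar_fun :> F -> C;
  addchar_neq0 : forall x, addchar_fun x != 0;
  addcharD : {morph addchar_fun : x y / x + y >-> x * y}
}.

Section DiscreteSeries.
Variables (n : nat) (F : finFieldType) (C : fieldType) (theta : addchar F C).

Local Notation U := (unitri n F).
Local Notation CU := {ffun U -> C^o}.

Definition regact (g : U) (v : CU) : CU := [ffun g' => v (g' * g)%g].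

Fact regact_linear g : linear (regact g).
Proof. by move=> a u v; apply/ffunP => x; rewrite !ffunE. Qed.
HB.instance Definition _ g :=
  GRing.isLinear.Build C CU CU _ (regact g) (regact_linear g).

Definition vfun (l : nildual n F) : CU :=
  [ffun g => theta (nileval l (unitri_mx g - 1%:M))].

Definition discrete_module : {vspace CU} :=
  <<[seq vfun l | l in discrete_functionals n F]>>%VS.

Fact regact1 v : regact 1%g v = v.
Proof. by apply/ffunP => x; rewrite ffunE mulg1. Qed.

Fact regactM g h v : regact (g * h)%g v = regact g (regact h v).
Proof. by apply/ffunP => x; rewrite !ffunE mulgA. Qed.

Let lact_fun (l : nildual n F) (g : U) (X : subvs_of (nilalg n F)) : F^o :=
  nileval l (vsval X *m unitri_mx g).

Fact lact_fun_linear l g : linear (lact_fun l g).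
Proof.
move=> a X Y; rewrite /lact_fun /nileval.
have -> : val (a *: X + Y) *m unitri_mx g = a *: (vsval X *m unitri_mx g) + val Y *m unitri_mx g.
  by rewrite linearP mulmxDl -scalemxAl.
by rewrite !linearP.
Qed.

(* The left action (g * l)(X) = l(X g). *)
Definition lact (g : U) (l : nildual n F) : nildual n F :=
  let f := lact_fun l g in
  let flin := GRing.isLinear.Build _ _ _ _ f (lact_fun_linear l g) in
  linfun (HB.pack_for {linear subvs_of (nilalg n F) -> F^o} f flin).

Lemma nilalg_mulr (X : 'M[F]_n) (g : U) :
  X \in nilalg n F -> X *m unitri_mx g \in nilalg n F.
Proof.
move=> /nilalgP X0; apply/nilalgP => i j le_ji; rewrite mxE big1 // => k _.
have [/X0 ->|lt_ik] := leqP k i; first by rewrite mul0r.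
have lt_jk := leq_ltn_trans le_ji lt_ik; have gP := unitriE g.
by rewrite gP 1?ltnW // (ord_gt_eqF lt_jk) mulr0.
Qed.

Lemma unitri_sub1 (g : U) : unitri_mx g - 1%:M \in nilalg n F.
Proof.
apply/nilalgP => i j le_ji; have gP := unitriE g.
by rewrite !mxE gP // subrr.
Qed.

Lemma nilevalD (l : nildual n F) : {morph nileval l : X Y / X + Y}.
Proof. by move=> X Y; rewrite /nileval !linearD. Qed.

Lemma lactE g l X :
  X \in nilalg n F -> nileval (lact g l) X = nileval l (X *m unitri_mx g).
Proof.
by move=> Xn; rewrite {1}/nileval lfunE /= /lact_fun vsprojK.
Qed.

Lemma lact_discrete g l :
  l \in discrete_functionals n F -> lact g l \in discrete_functionals n F.
Proof.
rewrite !inE => /forallP lD; apply/forallP => i; apply/implyP => lt_in.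
have := lD i; rewrite lt_in => /existsP[j0 j0P].
have [j jP jmax] :=
  @arg_maxnP _ j0 (fun j => (i, j) \in nilsupp l) (@nat_of_ord n) j0P.
apply/existsP; exists j; move: jP; rewrite !inE /= => /andP[lt_ij lj].
have en (k : 'I_n) : (i < k)%N -> delta_mx i k \in nilalg n F.
  move=> lt_ik; apply/nilalgP => a b le_ba; rewrite mxE.
  by case: eqP => [ea|//]; case: eqP => [eb|//]; move: le_ba; rewrite ea eb leqNgt lt_ik.
rewrite lt_ij lactE ?en //=.
have -> : delta_mx i j *m unitri_mx g = \sum_k unitri_mx g j k *: delta_mx i k.
  apply/matrixP => a b; rewrite !mxE summxE (bigD1 j) //= big1 ?addr0; last first.
    by move=> k /negPf nk; rewrite mxE nk andbF mul0r.
  rewrite (bigD1 b) //= big1 ?addr0; last first.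
    by move=> k nk; rewrite !mxE [b == k]eq_sym (negPf nk) andbF mulr0.
  by rewrite !mxE !eqxx andbT mulrC.
have gP := unitriE g.
rewrite /nileval !linear_sum (bigD1 j) //= gP // eqxx scale1r.
rewrite big1 ?addr0 // => k nkj; rewrite !linearZ /=.
have [le_kj|lt_jk] := leqP k j.
  by rewrite gP // eq_sym (negPf nkj) scale0r.
suff -> : (l : 'Hom(_, _)) (vsproj (nilalg n F) (delta_mx i k)) = 0 by rewrite scaler0.
apply/eqP/negPn/negP => lk; have /jmax : (i, k) \in nilsupp l.
  by rewrite inE /= (ltn_trans lt_ij lt_jk).
by rewrite /= leqNgt lt_jk.
Qed.

Lemma regact_vfun g l :
  regact g (vfun l) = vfun l g *: vfun (lact g l).
Proof.
apply/ffunP => h; rewrite !ffunE /=.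
have -> : nileval l (unitri_mx (h * g)%g - 1%:M) =
    nileval l (unitri_mx g - 1%:M) + nileval (lact g l) (unitri_mx h - 1%:M).
  rewrite lactE ?unitri_sub1 // -nilevalD.
  by rewrite mulmxBl mul1mx -unitri_mxM [in RHS]addrC subrKA.
by rewrite addcharD.
Qed.

Lemma discrete_module_stable g v :
  v \in discrete_module -> regact g v \in discrete_module.
Proof.
move=> vD; apply: (span_ind (P := fun v => regact g v \in discrete_module)) vD.
- by rewrite linear0 mem0v.
- by move=> a u w uD wD; rewrite linearP; apply: memvD => //; apply: memvZ.
move=> _ /imageP[l lD ->]; rewrite regact_vfun; apply/memvZ/memv_span/imageP.
by exists (lact g l) => //; apply: lact_discrete.
Qed.

(* Matrix of the restriction of regact g to discrete_module, column j holding
   the coordinates of the image of the j-th basis vector. *)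
Definition discrete_mx (g : U) : 'M[C]_(\dim discrete_module) :=
  let b := vbasis discrete_module in
  \matrix_(i, j) coord b i (regact g b`_j).

Fact discrete_mx_repr : mx_repr [set: U] discrete_mx.
Proof.
have bf : free (vbasis discrete_module) by apply/basis_free/vbasisP.
have bm j : (j < \dim discrete_module)%N ->
    (vbasis discrete_module)`_j \in discrete_module.
  by move=> lt_j; apply/vbasis_mem/mem_nth; rewrite size_tuple.
split=> [|g h _ _]; apply/matrixP => i j; rewrite !mxE.
  by rewrite regact1 coord_free // eq_sym.
rewrite regactM {1}(coord_vbasis (discrete_module_stable h (bm j (ltn_ord j)))).
rewrite !linear_sum; apply: eq_bigr => k _.
by rewrite !mxE !linearZ /= mulrC.
Qed.

Definition discrete_repr : mx_representation C [set: U] (\dim discrete_module) :=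
  MxRepresentation discrete_mx_repr.

Definition discrete_char (g : U) : C := \tr (discrete_repr g).

End DiscreteSeries.

(* Main.v *)
From HB Require Import structures.
Require Import Defs.
From mathcomp Require Import all_boot all_order all_fingroup all_algebra.
From mathcomp Require Import all_field all_character.
From mathcomp Require Import zify.

(** Write N = g - 1, q for the order of F, and identify a functional l with
the n rows l_1, ..., l_n of its values on the matrix units, l_i being supported
on the columns after i.

The functions v(l) are pairwise orthogonal additive characters in g - 1, so
those with l in Delta form a basis of the discrete series module. The group
permutes this basis up to scalars, g * v(l) = theta(l(N)) v(g * l), and the
trace is the sum of theta(l(N)) over the l in Delta that g fixes
([discrete_char_sum]).

Both the condition and the summand split over the rows of l. Indeed g fixes l
when l(X N) = 0 for every X, that is, when row l_i is orthogonal to the rows of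
N below the i-th one, for each i; and l(N) is the sum of the products of l_i
with row i of N. Hence the trace is a product over i of sums of an additive
character over the nonzero vectors of a linear space ([discrete_sum_prod]); the
last row of l is zero and contributes a factor 1. The
condition on l_i, its support included, says that it is orthogonal to the rows
of the matrix B_i obtained from N by replacing its first i rows by those of the
identity ([flag_mx]). The sum over all vectors of that space is its cardinal
if row i of N is a combination of the rows of B_i, and 0 otherwise; removing
the zero vector subtracts 1.

Let D_i = n - rank B_i. Going up from B_i to B_(i-1) trades the i-th identity
row for row i of N. The former is independent of the other rows, so the rank
drops by one when row i of N depends on them, and is unchanged otherwise
([mxrank_flagS]). So the factor of row i is q^D_i - 1 when D_(i-1) = D_i + 1,
and -1 when D_(i-1) = D_i. As D starts at 1 (the last row of N is zero) and
ends at n - rank N, the factors of the first kind are exactly q^k - 1 for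
1 <= k < n - rank N, and there are rank N factors -1 ([prod_signed_steps]). *)

Set Implicit Arguments.
Unset Strict Implicit.
Unset Printing Implicit Defensive.

Import GRing.Theory Num.Theory.

Local Open Scope ring_scope.

(** * Traces and additive characters *)

(** Expanding each basis in the other one gives the same double sum for both
traces; the two lengths are kept apart because neither is syntactically the
dimension of D. *)
Lemma trace_basis (K : fieldType) (vT : vectType K) (D : {vspace vT})
    (f : {linear vT -> vT}) m n (X : m.-tuple vT) (Y : n.-tuple vT) :
  basis_of D X -> basis_of D Y -> (forall v, v \in D -> f v \in D) ->
  \sum_i coord X i (f X`_i) = \sum_i coord Y i (f Y`_i).
Proof.
move=> bX bY fD.
have XD (i : 'I_m) : X`_i \in D.
  by apply: (basis_mem bX); rewrite mem_nth ?size_tuple.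
have YD (i : 'I_n) : Y`_i \in D.
  by apply: (basis_mem bY); rewrite mem_nth ?size_tuple.
pose t (i : 'I_m) (k : 'I_n) := coord Y k X`_i * coord X i (f Y`_k).
transitivity (\sum_i \sum_k t i k).
  apply: eq_bigr => i _; rewrite [in LHS](coord_basis bY (XD i)) !linear_sum.
  by apply: eq_bigr => k _; rewrite !linearZ.
rewrite exchange_big; apply: eq_bigr => k _.
rewrite [in RHS](coord_basis bX (fD _ (YD k))) linear_sum.
by apply: eq_bigr => i _; rewrite linearZ /t mulrC.
Qed.

Section AdditiveCharacter.
Variables (F : finFieldType) (C : fieldType) (theta : addchar F C).

Lemma addchar0 : theta 0 = 1.
Proof.
apply: (mulIf (addchar_neq0 theta 0)).
by rewrite mul1r -addcharD addr0.
Qed.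

Lemma addcharN x : theta (- x) = (theta x)^-1.
Proof.
apply: (mulIf (addchar_neq0 theta x)).
by rewrite -addcharD addNr addchar0 mulVf ?addchar_neq0.
Qed.

Lemma addchar_sum (I : Type) (r : seq I) (P : pred I) (f : I -> F) :
  theta (\sum_(i <- r | P i) f i) = \prod_(i <- r | P i) theta (f i).
Proof. exact: (big_morph _ (addcharD theta) addchar0). Qed.

Lemma addchar_scale_neq1 y :
  (exists x, theta x != 1) -> y != 0 -> exists a, theta (a * y) != 1.
Proof. by case=> x tx y0; exists (x / y); rewrite divfK. Qed.

(** The usual orthogonality argument: the substitution s multiplies the sum by
c. *)
Lemma sum_twisted_eq0 (T : finType) (P : pred T) (f : T -> C) (s : T -> T) c :
  injective s -> (forall x, P (s x) = P x) -> (forall x, f (s x) = c * f x) ->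
  c != 1 -> \sum_(x | P x) f x = 0.
Proof.
move=> s_inj Ps fs c1; set S := \sum_(x | P x) f x.
have : S = c * S.
  rewrite {1}/S (reindex_inj s_inj) mulr_sumr.
  by apply: eq_big => x; rewrite ?Ps ?fs.
move/eqP; rewrite -{1}[S]mul1r -subr_eq0 -mulrBl mulf_eq0 subr_eq0 eq_sym.
by rewrite (negPf c1) => /eqP.
Qed.

Lemma card_ker_tr m n (B : 'M[F]_(m, n)) :
  #|[pred v : 'rV[F]_n | v *m B^T == 0]| = (#|F| ^ (n - \rank B))%N.
Proof.
rewrite -mxrank_tr -mxrank_ker -card_rowg; apply: eq_card => v.
by rewrite !inE; apply/eqP/sub_kermxP.
Qed.

(** The linear form v |-> <v, u> vanishes on the orthogonal of the rows of B
exactly when u is a combination of these rows; if it does not, theta of it is a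
nontrivial character of that orthogonal. *)
Lemma sum_addchar_ker m n (B : 'M[F]_(m, n)) (u : 'rV[F]_n) :
    (exists x, theta x != 1) ->
  \sum_(v : 'rV[F]_n | v *m B^T == 0) theta ((v *m u^T) 0 0) =
    if (u <= B)%MS then #|F|%:R ^+ (n - \rank B) else 0.
Proof.
move=> nt; case: ifPn => [/submxP[d ->]|].
  rewrite -natrX -card_ker_tr -sum1_card natr_sum.
  apply: eq_bigr => v /eqP vB.
  by rewrite trmx_mul mulmxA vB mul0mx mxE addchar0.
rewrite submxE => /rV0Pn[j nz].
have [a ta] := addchar_scale_neq1 nt nz.
(* A column of the cokernel is orthogonal to the rows of B; it is scaled so
   that theta separates its product with u from 1. *)
pose w : 'rV[F]_n := a *: (col j (cokermx B))^T.
have wB : w *m B^T = 0.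
  apply: trmx_inj; rewrite trmx_mul trmxK linearZ /= trmxK -scalemxAr colE.
  by rewrite mulmxA mulmx_coker mul0mx scaler0 trmx0.
have wu : (w *m u^T) 0 0 = a * (u *m cokermx B) 0 j.
  by rewrite -scalemxAl mxE -trmx_mul colE mulmxA -colE !mxE.
apply: (@sum_twisted_eq0 _ _ _ (+%R w) (theta ((w *m u^T) 0 0))).
- exact: addrI.
- by move=> v; rewrite mulmxDl wB add0r.
- by move=> v; rewrite mulmxDl mxE addcharD.
- by rewrite wu.
Qed.

Lemma sum_addchar_ker_neq0 m n (B : 'M[F]_(m, n)) (u : 'rV[F]_n) :
    (exists x, theta x != 1) ->
  \sum_(v : 'rV[F]_n | (v *m B^T == 0) && (v != 0)) theta ((v *m u^T) 0 0) =
    (if (u <= B)%MS then #|F|%:R ^+ (n - \rank B) else 0) - 1.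
Proof.
move=> nt; rewrite -sum_addchar_ker // [in RHS](bigD1 0) ?mul0mx //=.
by rewrite mxE addchar0 addrAC subrr add0r.
Qed.

End AdditiveCharacter.

(** * Ranks along the rows of a strictly triangular matrix *)

Lemma mxrank_adds_row (F : fieldType) m n (A : 'M[F]_(m, n)) (u : 'rV_n) :
  \rank (A + u)%MS = (\rank A + ~~ (u <= A)%MS)%N.
Proof.
have [uA|nuA] := boolP (u <= A)%MS; first by rewrite (addsmx_idPl uA) addn0.
apply/eqP; rewrite eqn_leq addn1; apply/andP; split.
  rewrite (leq_trans (mxrank_adds_leqif A u)) // -[leqRHS]addn1.
  by rewrite leq_add2l rank_leq_row.
suff: (A < A + u)%MS by rewrite ltmxErank => /andP[].
by rewrite ltmxE addsmxSl addsmx_sub submx_refl.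
Qed.

Lemma mulmx_trE (R : comNzRingType) m n (v : 'rV[R]_n) (A : 'M_(m, n)) j :
  (v *m A^T) 0 j = (v *m (row j A)^T) 0 0.
Proof. by rewrite tr_row colE mulmxA -colE [RHS]mxE. Qed.

Section FlagRank.
Variables (F : fieldType) (n : nat) (N : 'M[F]_n).
Hypothesis N0 : forall i j : 'I_n, (j <= i)%N -> N i j = 0.

(** The identity rows encode the support condition: a vector orthogonal to the
rows of [flag_mx k] vanishes on its first k coordinates and is orthogonal to
the rows of N from the k-th one on. *)
Definition flag_mx k : 'M[F]_n :=
  \matrix_(a, b) if (a < k)%N then (a == b)%:R else N a b.

Lemma row_flag_mx k (i : 'I_n) :
  row i (flag_mx k) = if (i < k)%N then delta_mx 0 i else row i N.
Proof.
by apply/rowP => j; rewrite !mxE; case: ltnP => _; rewrite !mxE // eqxx eq_sym.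
Qed.

(** The part shared by [flag_mx i] and [flag_mx i.+1], which differ in row i. *)
Let common_rows (i : 'I_n) : 'M[F]_n :=
  \matrix_(a, b) if a == i then 0 else flag_mx i a b.

Let row_common (i a : 'I_n) :
  row a (common_rows i) = if a == i then 0 else row a (flag_mx i).
Proof. by apply/rowP => j; rewrite !mxE; case: eqP; rewrite !mxE. Qed.

Let flag_mx_common (i : 'I_n) k :
  (k == i :> nat) || (k == i.+1) ->
  (flag_mx k :=: common_rows i + row i (flag_mx k))%MS.
Proof.
move=> ki.
have other a : a != i -> row a (flag_mx k) = row a (common_rows i).
  move=> ai; rewrite row_common (negPf ai) !row_flag_mx.
  case/orP: ki => /eqP -> //.
  by rewrite ltnS leq_eqVlt val_eqE (negPf ai).
apply/eqmxP; rewrite addsmx_sub row_sub andbT; apply/andP; split.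
  apply/row_subP => a; have [->|ai] := eqVneq a i; first exact: addsmxSr.
  by rewrite other // (submx_trans (row_sub _ _)) ?addsmxSl.
apply/row_subP => a; have [->|ai] := eqVneq a i.
  by rewrite row_common eqxx sub0mx.
by rewrite -other ?row_sub.
Qed.

Let common_col (i a : 'I_n) : common_rows i a i = 0.
Proof.
rewrite !mxE; case: eqVneq => // ai.
by have [//|le_ia] := ltnP; apply: N0.
Qed.

Let sub_common_col (i : 'I_n) (u : 'rV_n) : (u <= common_rows i)%MS -> u 0 i = 0.
Proof.
by case/submxP=> d ->; rewrite mxE big1 // => a _; rewrite common_col mulr0.
Qed.

(** The two matrices differ in row i only. In [flag_mx i.+1] it is the unit
vector e_i, independent of the other rows because their i-th entries are zero;
the rank of [flag_mx i] is smaller exactly when row i of N depends on the other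
rows. Allowing e_i among these changes nothing, as row i of N also has i-th
entry zero. *)
Lemma mxrank_flagS (i : 'I_n) :
  \rank (flag_mx i.+1) = (\rank (flag_mx i) + (row i N <= flag_mx i.+1)%MS)%N.
Proof.
have eS : (flag_mx i.+1 :=: common_rows i + (delta_mx 0 i : 'rV_n))%MS.
  by have := @flag_mx_common i i.+1; rewrite row_flag_mx leqnn eqxx orbT; apply.
have e0 : (flag_mx i :=: common_rows i + row i N)%MS.
  by have := @flag_mx_common i i; rewrite row_flag_mx ltnn eqxx; apply.
have -> : (row i N <= flag_mx i.+1)%MS = (row i N <= common_rows i)%MS.
  apply/idP/idP => [|h]; rewrite eS; last exact: submx_trans h (addsmxSl _ _).
  case/sub_addsmxP => [[d c]] /= e.
  suff c0 : c = 0 by rewrite e c0 mul0mx addr0 submxMl.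
  have := congr1 (fun u : 'rV_n => u 0 i) e.
  rewrite [c]mx11_scalar mul_scalar_mx !mxE N0 // big1 => [|a _].
    by rewrite add0r !eqxx mulr1 => <-; rewrite raddf0.
  by have := common_col i a; rewrite mxE => ->; rewrite mulr0.
rewrite eS e0 !mxrank_adds_row -addnA; congr (_ + _)%N.
have -> : ((delta_mx 0 i : 'rV_n) <= common_rows i)%MS = false.
  apply/negP => /sub_common_col /eqP; rewrite mxE !eqxx.
  by rewrite oner_eq0.
by case: (row i N <= _)%MS.
Qed.

Lemma flag_mx0 : flag_mx 0 = N.
Proof. by apply/matrixP => i j; rewrite mxE. Qed.

Lemma mxrank_flag_full : \rank (flag_mx n) = n.
Proof.
rewrite (_ : flag_mx n = 1%:M) ?mxrank1 //.
by apply/matrixP => i j; rewrite !mxE ltn_ord.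
Qed.

End FlagRank.

(** Each factor is either -1 or q^d - 1, and the exponent d grows by one exactly
at the factors of the second kind, so those run through q - 1, q^2 - 1, ... *)
Lemma prod_signed_steps (R : comNzRingType) (q : R) m
    (d : nat -> nat) (b : nat -> bool) :
    d 0%N = 1%N -> (forall j, (j < m)%N -> d j.+1 = (d j + b j)%N) ->
  (d m <= m.+1)%N /\
  \prod_(0 <= j < m) ((if b j then q ^+ d j else 0) - 1) =
    (-1) ^+ (m.+1 - d m) * \prod_(1 <= k < d m) (q ^+ k - 1).
Proof.
move=> d0; elim: m => [|m IH] dS.
  by rewrite d0 big_geq // big_geq // mulr1.
have [|le_d IHp] := IH; first by move=> j jm; apply: dS; rewrite ltnW.
have d_gt0 j : (j <= m.+1)%N -> (0 < d j)%N.
  by elim: j => [|j IHj] jm; rewrite ?d0 // dS // addn_gt0 IHj // ltnW.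
rewrite big_nat_recr //= IHp dS //; case: (b m).
  rewrite addn1 ltnS subSS; split=> //.
  by rewrite [in RHS]big_nat_recr ?d_gt0 //= mulrA.
rewrite addn0 (subSn le_d) exprS sub0r; split; first exact: leqW.
by rewrite mulrN1 mulN1r mulNr.
Qed.

(** * Functionals as families of rows *)

Section Functionals.
Variables (n : nat) (F : finFieldType).
Local Notation nd := (nildual n F).

Lemma delta_nilalg (i j : 'I_n) : (i < j)%N -> delta_mx i j \in nilalg n F.
Proof.
move=> lt_ij; apply/nilalgP => a b le_ba; rewrite mxE.
case: eqP => // ea; case: eqP => // eb.
by move: le_ba; rewrite ea eb leqNgt lt_ij.
Qed.

Definition coord_rows (l : nd) : {ffun 'I_n -> 'rV[F]_n} :=
  [ffun i : 'I_n =>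
     \row_(j < n) if (i < j)%N then nileval l (delta_mx i j) else 0].

Lemma nilevalE (l : nd) (X : 'M[F]_n) : X \in nilalg n F ->
  nileval l X = \sum_i (coord_rows l i *m (row i X)^T) 0 0.
Proof.
move=> /nilalgP X0; rewrite /nileval {1}(matrix_sum_delta X) !linear_sum /=.
apply: eq_bigr => i _; rewrite !linear_sum mxE; apply: eq_bigr => j _.
rewrite !linearZ /= ffunE !mxE [RHS]mulrC.
by case: ltnP => // /X0 ->; rewrite scale0r mul0r.
Qed.

Lemma nileval_delta_mul (l : nd) (i j : 'I_n) (Y : 'M[F]_n) :
  delta_mx i j *m Y \in nilalg n F ->
  nileval l (delta_mx i j *m Y) = (coord_rows l i *m (row j Y)^T) 0 0.
Proof.
move=> YN; rewrite nilevalE // (bigD1 i) //= big1 ?addr0 => [|k ki].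
  by rewrite row_mul rowE mul_delta_mx -rowE.
by rewrite row_mul rowE mul_delta_mx_0 // mul0mx trmx0 mulmx0 mxE.
Qed.

Lemma nileval_inj (l l' : nd) :
  (forall X, X \in nilalg n F -> nileval l X = nileval l' X) -> l = l'.
Proof.
move=> e; apply/lfunP => x.
by have := e _ (subvsP x); rewrite /nileval !vsvalK.
Qed.

Lemma coord_rows_inj : injective coord_rows.
Proof. by move=> l l' e; apply: nileval_inj => X XN; rewrite !nilevalE ?e. Qed.

Let rows_fun (f : {ffun 'I_n -> 'rV[F]_n}) (X : subvs_of (nilalg n F)) : F^o :=
  \sum_i (f i *m (row i (vsval X))^T) 0 0.

Let rows_fun_linear f : linear (rows_fun f).
Proof.
move=> a X Y; rewrite /rows_fun scaler_sumr -big_split; apply: eq_bigr => i _ /=.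
by rewrite !linearP /= !mxE.
Qed.

Definition functional_of_rows f : nd :=
  let flin := GRing.isLinear.Build _ _ _ _ (rows_fun f) (rows_fun_linear f) in
  linfun (HB.pack_for {linear subvs_of (nilalg n F) -> F^o} (rows_fun f) flin).

Lemma functional_of_rowsE f X : X \in nilalg n F ->
  nileval (functional_of_rows f) X = \sum_i (f i *m (row i X)^T) 0 0.
Proof. by move=> XN; rewrite /nileval lfunE /= /rows_fun vsprojK. Qed.

Lemma functional_of_rowsK (f : {ffun 'I_n -> 'rV[F]_n}) :
  (forall i j : 'I_n, (j <= i)%N -> f i 0 j = 0) ->
  coord_rows (functional_of_rows f) = f.
Proof.
move=> f0; apply/ffunP => i; apply/rowP => j; rewrite ffunE mxE.
case: ltnP => [lt_ij|/f0 -> //].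
rewrite functional_of_rowsE ?delta_nilalg // (bigD1 i) //= big1 => [|k ki].
  by rewrite addr0 rowE mul_delta_mx trmx_delta -colE mxE.
by rewrite rowE mul_delta_mx_0 // trmx0 mulmx0 mxE.
Qed.

Lemma coord_rowsK : cancel coord_rows functional_of_rows.
Proof.
move=> l; apply/coord_rows_inj/functional_of_rowsK => i j le_ji.
by rewrite ffunE mxE ltnNge le_ji.
Qed.

Lemma discrete_coord_rows (l : nd) :
  (l \in discrete_functionals n F) =
  [forall i : 'I_n, (i.+1 < n)%N ==> (coord_rows l i != 0)].
Proof.
rewrite inE; apply: eq_forallb => i; congr (_ ==> _).
apply/existsP/rV0Pn => [] [j]; last first.
  rewrite ffunE mxE; case: ifP => [lt_ij nz|]; last by rewrite eqxx.
  by exists j; rewrite inE /= lt_ij.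
by rewrite inE /= => /andP[lt_ij nz]; exists j; rewrite ffunE mxE lt_ij.
Qed.

(** Testing g * l = l on the unit e_ij with i < j gives l(e_ij N) = 0, and
l(e_ij N) is the product of row i of l with row j of N. The rows j <= i of
[flag_mx] give no further condition, since row i of l vanishes there. *)
Lemma lact_fixP (g : unitri n F) (l : nd) :
  reflect (forall i : 'I_n,
      coord_rows l i *m (flag_mx (unitri_mx g - 1%:M) i.+1)^T = 0)
    (lact g l == l).
Proof.
set N := unitri_mx g - 1%:M.
have dN (i j : 'I_n) : (i < j)%N -> delta_mx i j *m N \in nilalg n F.
  move=> lt_ij; rewrite mulmxBr mulmx1.
  by rewrite memvB ?nilalg_mulr ?delta_nilalg.
have lactD (i j : 'I_n) : (i < j)%N -> nileval (lact g l) (delta_mx i j) =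
    nileval l (delta_mx i j) + (coord_rows l i *m (row j N)^T) 0 0.
  move=> lt_ij; rewrite lactE ?delta_nilalg // -nileval_delta_mul ?dN //.
  by rewrite -nilevalD -[X in X + _]mulmx1 -mulmxDr addrC subrK.
have rowsE (i j : 'I_n) : (coord_rows l i *m (flag_mx N i.+1)^T) 0 j =
    if (j <= i)%N then 0 else (coord_rows l i *m (row j N)^T) 0 0.
  rewrite mulmx_trE row_flag_mx ltnS; case: leqP => // le_ji.
  by rewrite trmx_delta -colE !mxE ffunE mxE ltnNge le_ji.
apply: (iffP eqP) => [fix_l i|h].
  apply/rowP => j; rewrite rowsE [RHS]mxE; case: leqP => // lt_ij.
  have := lactD i j lt_ij; rewrite fix_l => /esym/eqP.
  by rewrite -subr_eq0 addrAC subrr add0r => /eqP.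
apply/coord_rows_inj/ffunP => i; apply/rowP => j; rewrite !ffunE !mxE.
case: ltnP => // lt_ij; rewrite lactD //.
have := rowsE i j; rewrite h mxE leqNgt lt_ij /= => <-.
by rewrite addr0.
Qed.

End Functionals.

(** * The trace of the discrete series module *)

Section DiscreteModule.
Variables (n : nat) (F : finFieldType) (C : numFieldType) (theta : addchar F C).
Hypothesis nontrivial : exists x : F, theta x != 1.
Local Notation U := (unitri n F).

Lemma unitri_translate (h : U) (X : 'M[F]_n) :
  X \in nilalg n F -> is_unitri (unitri_mx h + X).
Proof.
move=> /nilalgP X0; apply/is_unitriP => i j le_ji.
by rewrite mxE X0 // addr0 unitriE.
Qed.

(** If l and l' differ at some X, translating h by a suitable multiple of X
multiplies every term by the same constant, different from 1. *)
Lemma vfun_orthogonal (l l' : nildual n F) :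
  \sum_(h : U) vfun theta l h / vfun theta l' h =
    if l == l' then #|{: U}|%:R else 0.
Proof.
have [<-|/lfunPn[u neq_u]] := eqVneq l l'.
  rewrite -sum1_card natr_sum; apply: eq_bigr => h _.
  by rewrite ffunE divff ?addchar_neq0.
pose y X := nileval l X - nileval l' X.
have [a ta] : exists a, theta (a * y (vsval u)) != 1.
  by apply: addchar_scale_neq1; rewrite // /y /nileval vsvalK subr_eq0.
pose X := a *: vsval u.
have XN : X \in nilalg n F by rewrite memvZ ?subvsP.
have sE (h : U) : unitri_mx (insubd h (unitri_mx h + X)) = unitri_mx h + X.
  exact: insubdK (unitri_translate h XN).
pose s (h : U) : U := insubd h (unitri_mx h + X).
apply: (@sum_twisted_eq0 _ _ _ _ s (theta (a * y (vsval u)))) => // [h k|h].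
  by move/(congr1 (@unitri_mx _ _)); rewrite !sE => /addIr/val_inj.
rewrite !ffunE sE -!addcharN -!addcharD; congr (theta _).
rewrite addrAC !nilevalD.
have yX : a * y (vsval u) = nileval l X - nileval l' X.
  by rewrite /y /nileval !linearZ /= -mulrBr.
by rewrite yX opprD addrACA addrC.
Qed.

Lemma vfun_free (A : {set nildual n F}) : free (image_tuple (vfun theta) A).
Proof.
apply/freeP => k k0 i.
have nth_vfun (j : 'I_#|A|) :
    (image_tuple (vfun theta) A)`_j = vfun theta (enum_val j).
  exact: nth_image.
have : \sum_(h : U) (\sum_j k j *: (image_tuple (vfun theta) A)`_j) h
    / vfun theta (enum_val i) h = 0.
  by rewrite k0 big1 // => h _; rewrite ffunE mul0r.
under eq_bigr => h _.
  rewrite sum_ffunE mulr_suml; under eq_bigr => j _ do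
    rewrite nth_vfun ffunE -mulrA.
  over.
rewrite exchange_big /= (bigD1 i) //= -mulr_sumr vfun_orthogonal eqxx.
rewrite big1 ?addr0 => [/eqP|j ji]; last first.
  by rewrite -mulr_sumr vfun_orthogonal (inj_eq enum_val_inj) (negPf ji) mulr0.
rewrite mulf_eq0 pnatr_eq0 => /orP[/eqP //|/eqP card0].
by have := card0_eq card0 1%g; rewrite inE.
Qed.

(** In the basis of the v(l) the matrix of g is monomial, so only the l fixed by
g contribute to the trace. *)
Lemma discrete_char_sum (g : U) :
  discrete_char theta g =
    \sum_(l in discrete_functionals n F | lact g l == l)
      theta (nileval l (unitri_mx g - 1%:M)).
Proof.
set A := discrete_functionals n F.
pose Y := image_tuple (vfun theta) A.
have Yfree : free Y := vfun_free A.
have Ybasis : basis_of (discrete_module n theta) Y.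
  by rewrite basisEfree Yfree subvv; apply: eq_leq (eqP Yfree).
have nthY (j : 'I_#|A|) : Y`_j = vfun theta (enum_val j) by exact: nth_image.
rewrite /discrete_char /mxtrace.
under eq_bigr => i _ do rewrite mxE.
rewrite (@trace_basis _ _ (discrete_module n theta) (regact g) _ _ _ Y)
  ?vbasisP //; last exact: discrete_module_stable.
rewrite [RHS]big_mkcondr [RHS]big_enum_val; apply: eq_bigr => i _.
have lA := lact_discrete g (enum_valP i).
rewrite nthY /= regact_vfun linearZ /= ffunE -(enum_rankK_in (enum_valP i) lA).
rewrite -nthY coord_free // (inj_eq enum_val_inj).
by case: eqP => _; rewrite (mulr1, mulr0).
Qed.

Lemma discrete_sum_prod (g : U) (N := unitri_mx g - 1%:M) :
  \sum_(l in discrete_functionals n F | lact g l == l) theta (nileval l N) =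
  \prod_(i < n) \sum_(v : 'rV[F]_n | (v *m (flag_mx N i.+1)^T == 0)
      && ((i.+1 < n)%N ==> (v != 0))) theta ((v *m (row i N)^T) 0 0).
Proof.
rewrite bigA_distr_big_dep.
rewrite (reindex_onto (@coord_rows n F) (@functional_of_rows n F)) /=.
  apply: eq_big => [l|l _]; last by rewrite nilevalE ?unitri_sub1 // addchar_sum.
  rewrite coord_rowsK eqxx andbT discrete_coord_rows.
  apply/andP/familyP => [[/forallP nz /lact_fixP fix_l] i|h].
    by rewrite unfold_in fix_l eqxx nz.
  split; first by apply/forallP => i; have := h i; rewrite unfold_in => /andP[].
  by apply/lact_fixP => i; have := h i; rewrite unfold_in => /andP[/eqP].
move=> f /familyP h; apply: functional_of_rowsK => i j le_ji.
have := h i; rewrite unfold_in => /andP[/eqP/rowP/(_ j) + _].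
by rewrite mulmx_trE row_flag_mx ltnS le_ji trmx_delta -colE !mxE.
Qed.

End DiscreteModule.

Theorem theorem8p2 (n : nat) (n_gt0 : (0 < n)%N) (F : finFieldType)
    (C : numClosedFieldType) (theta : addchar F C)
    (theta_nontrivial : exists x : F, theta x != 1) (g : unitri n F) :
  let r : nat := \rank (unitri_mx g - 1%:M) in
  discrete_char theta g =
    (-1) ^+ r * \prod_(1 <= k < n - r) (#|F|%:R ^+ k - 1).
Proof.
rewrite discrete_char_sum // discrete_sum_prod.
case: n n_gt0 g => // m _ g r; set N := unitri_mx g - 1%:M.
have N0 : forall i j : 'I_m.+1, (j <= i)%N -> N i j = 0.
  exact/nilalgP/unitri_sub1.
(* The rows are taken from the last but one upwards: step j concerns row
   m - 1 - j. *)
pose b j := (row (inord (m.-1 - j)) N <= flag_mx N (m - j))%MS.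
pose d j := (m.+1 - \rank (flag_mx N (m - j)))%N.
have row_last : row ord_max N = 0.
  by apply/rowP => j; rewrite mxE N0 ?leq_ord // mxE.
have d0 : d 0%N = 1%N.
  have := mxrank_flagS N0 ord_max; rewrite mxrank_flag_full row_last sub0mx.
  by rewrite /d subn0 addn1 => -[<-]; rewrite subSnn.
have dS j : (j < m)%N -> d j.+1 = (d j + b j)%N.
  move=> lt_jm; rewrite /d /b.
  have e : (m - j)%N = (inord (m.-1 - j) : 'I_m.+1).+1.
    by rewrite inordK; lia.
  have e' : (m - j.+1)%N = (inord (m.-1 - j) : 'I_m.+1) by lia.
  rewrite e' e.
  have := mxrank_flagS N0 (inord (m.-1 - j)).
  have := rank_leq_row (flag_mx N (inord (m.-1 - j) : 'I_m.+1).+1).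
  move=> + eq_rank; rewrite eq_rank => le_rank.
  by rewrite subnDA subnK // leq_subRL ?(leq_trans (leq_addr _ _) le_rank).
have [_ prodE] := prod_signed_steps (#|F|%:R : C) d0 dS.
(* The last row of a functional is zero and is not required to be nonzero:
   its factor is 1. *)
rewrite big_ord_recr /= ltnn /=.
under [X in _ * X]eq_bigl => v do rewrite andbT.
rewrite sum_addchar_ker // row_last sub0mx mxrank_flag_full subnn expr0 mulr1.
have dm : d m = (m.+1 - r)%N by rewrite /d subnn flag_mx0.
have r_le : (r <= m.+1)%N by apply: rank_leq_row.
rewrite -{1}(subKn r_le) -dm -prodE big_mkord (reindex_inj rev_ord_inj) /=.
apply: eq_bigr => j _; have lt_jm := ltn_ord j.
rewrite -subSn // subSS ltnS leq_subr /= sum_addchar_ker_neq0 //.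
have -> : widen_ord (leqnSn m) (rev_ord j) = inord (m.-1 - j).
  by apply/val_inj; rewrite /= inordK; lia.
by rewrite /b /d.
Qed.
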